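(* Let $Q$ be a finite quiver and $\Bbbk$ a field. Let $\widehat{Q}$ be the Kronecker square of $Q$, let $\Bbbk\widehat{Q}$ be its path algebra, and let $\mathfrak{H}(Q)$ be Hayashi's face algebra attached to $Q$ over $\Bbbk$. Then $\mathfrak{H}(Q)\cong\Bbbk\widehat{Q}$ as unital $\mathbb N$-graded $\Bbbk$-algebras.
   Context: A quiver is a directed graph $Q=(Q_0,Q_1,s,t)$ with vertex set $Q_0$, arrow set $Q_1$ and source and target maps $s,t:Q_1\to Q_0$ (loops and multiple arrows are allowed); it is finite if $Q_0$ and $Q_1$ are finite. Paths are read from left to right: a path of length $k\ge1$ is $p_1\cdots p_k$ with $p_i\in Q_1$ and $t(p_i)=s(p_{i+1})$, with source $s(p_1)$ and target $t(p_k)$. Paths of length $0$ are the vertices (trivial paths). $Q_k$ denotes the set of paths of length $k$. The path algebra $\Bbbk Q$ has as $\Bbbk$-basis all paths of $Q$ (including the trivial path $e_i$ for each $i\in Q_0$), with product of paths $a*b=\delta_{t(a),s(b)}\,ab$ and unit $\sum_{i\in Q_0}e_i$. It is $\mathbb N$-graded by path length. The Kronecker square of $Q$ is the quiver $\widehat{Q}=(\widehat{Q}_0,\widehat{Q}_1,\widehat{s},\widehat{t})$ with $\widehat{Q}_0=\{[i,j]\}_{i,j\in Q_0}$, $\widehat{Q}_1=\{[p,q]\}_{p,q\in Q_1}$, $\widehat{s}([p,q])=[s(p),s(q)]$ and $\widehat{t}([p,q])=[t(p),t(q)]$. Hayashi's face algebra $\mathfrak{H}(Q)$ is the $\Bbbk$-algebra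 with $\Bbbk$-basis $\{x_{a,b}: a,b\in Q_k,\ k\ge0\}$ and ring structure determined by: $x_{i,j}x_{i',j'}=\delta_{i,i'}\delta_{j,j'}x_{i,j}$ for $i,j,i',j'\in Q_0$; $x_{s(p),s(q)}x_{p,q}=x_{p,q}=x_{p,q}x_{t(p),t(q)}$ for $p,q\in Q_1$; and $x_{p,q}x_{p',q'}=\delta_{t(p),s(p')}\delta_{t(q),s(q')}x_{pp',qq'}$ for $p,p',q,q'\in Q_1$. Thus $x_{a,b}x_{c,d}=\delta_{t(a),s(c)}\delta_{t(b),s(d)}x_{ac,bd}$ for all $a,b\in Q_k$, $c,d\in Q_l$. The unit is $\sum_{i,j\in Q_0}x_{i,j}$, and the $\mathbb N$-grading is $\mathfrak{H}(Q)_k=\bigoplus_{a,b\in Q_k}\Bbbk x_{a,b}$. *)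

(* Defs.v *)
From HB Require Import structures.
From mathcomp Require Import all_boot all_order all_algebra.
From mathcomp Require Import finmap.
From mathcomp.multinomials Require Import monalg.

Set Implicit Arguments.
Unset Strict Implicit.
Unset Printing Implicit Defensive.

Import GRing.Theory.

Local Open Scope ring_scope.

(* Unital associative algebras graded by the natural numbers. The structure   *)
(* algType is not used because it excludes the zero algebra, which is what    *)
(* the quiver without vertices gives; and no HB structure on top of both      *)
(* pzRingType and lmodType can be added to the library hierarchy, whence the  *)
(* explicit scaling operation.                                                *)
Record ngradedAlg (k : fieldType) := NGradedAlg {
  ngalg_sort :> pzRingType;
  ascale : k -> ngalg_sort -> ngalg_sort;
  ascaleA : forall c d x, ascale c (ascale d x) = ascale (c * d) x;
  ascale1 : left_id 1 ascale;
  ascaleDr : right_distributive ascale +%R;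
  ascaleDl : forall x, {morph ascale^~ x : c d / c + d};
  ascaleAl : forall c x y, ascale c (x * y) = ascale c x * y;
  ascaleAr : forall c x y, ascale c (x * y) = x * ascale c y;
  homog : nat -> {pred ngalg_sort};
  homog0 : forall n, 0 \in homog n;
  homogD : forall n x y, x \in homog n -> y \in homog n -> x + y \in homog n;
  homogZ : forall n c x, x \in homog n -> ascale c x \in homog n;
  homog1 : 1 \in homog 0;
  homogM : forall m n x y,
    x \in homog m -> y \in homog n -> x * y \in homog (m + n);
  homog_span : forall x, exists n (c : nat -> ngalg_sort),
    (forall i, c i \in homog i) /\ x = \sum_(i < n) c i;
  homog_indep : forall n (c : nat -> ngalg_sort), (forall i, c i \in homog i) ->
    \sum_(i < n) c i = 0 -> forall i, (i < n)%N -> c i = 0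
}.

Arguments homog {k} _ _.

Definition graded_alg_iso (k : fieldType) (A B : ngradedAlg k) : Prop :=
  exists f : {rmorphism A -> B},
    [/\ bijective f,
        forall c x, f (ascale c x) = ascale c (f x)
      & forall n x, (f x \in homog B n) = (x \in homog A n)].

(* Categories with finitely many objects and an additive length on morphisms, *)
(* composed from left to right. [gcomp a b] is meaningful only if             *)
(* [gtgt a = gsrc b].                                                         *)
Record gradedCat := GradedCat {
  gob : finType;
  gmor : choiceType;
  gsrc : gmor -> gob;
  gtgt : gmor -> gob;
  gid : gob -> gmor;
  gcomp : gmor -> gmor -> gmor;
  glen : gmor -> nat;
  gsrc_id : forall i, gsrc (gid i) = i;
  gtgt_id : forall i, gtgt (gid i) = i;
  gsrc_comp : forall a b, gtgt a = gsrc b -> gsrc (gcomp a b) = gsrc a;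
  gtgt_comp : forall a b, gtgt a = gsrc b -> gtgt (gcomp a b) = gtgt b;
  gcompA : forall a b c, gtgt a = gsrc b -> gtgt b = gsrc c ->
    gcomp a (gcomp b c) = gcomp (gcomp a b) c;
  gcomp1 : forall a, gcomp a (gid (gtgt a)) = a;
  g1comp : forall a, gcomp (gid (gsrc a)) a = a;
  glen_id : forall i, glen (gid i) = 0%N;
  glen_comp : forall a b, gtgt a = gsrc b ->
    glen (gcomp a b) = (glen a + glen b)%N
}.

(* The algebra of such a category: the vector space with basis the morphisms, *)
(* the product of two of them being their composite if they are composable    *)
(* and 0 otherwise.                                                           *)
Definition catAlg (k : fieldType) (C : gradedCat) := {malg k[gmor C]}.

HB.instance Definition _ k C := Choice.on (catAlg k C).
HB.instance Definition _ k C := GRing.Lmodule.on (catAlg k C).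

Section CatAlg.
Variables (k : fieldType) (C : gradedCat).
Implicit Types (x y z : catAlg k C) (a b c : gmor C).

Definition cbasis a : catAlg k C := << a >>.

Definition bmul a b : catAlg k C := (gtgt a == gsrc b)%:R *: cbasis (gcomp a b).

Definition cmul x y : catAlg k C :=
  \sum_(a <- msupp x) \sum_(b <- msupp y) (x@_a * y@_b) *: bmul a b.

Definition cone : catAlg k C := \sum_(i : gob C) cbasis (gid i).

Definition chomog (n : nat) : {pred catAlg k C} :=
  [pred x : catAlg k C | all (fun a => glen a == n) (msupp x)].

Lemma cbasisE x : x = \sum_(a <- msupp x) x@_a *: cbasis a.
Proof.
rewrite {1}[x]monalgE; apply: eq_bigr => a _.
by apply/malgP => b; rewrite mcoeffZ !mcoeffU mulrnAr mulr1.
Qed.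

Lemma cbasis_coef a b : (cbasis a)@_b = (a == b)%:R.
Proof. by rewrite mcoeffU. Qed.

Lemma cmulEw (d1 d2 : {fset gmor C}) x y :
  (msupp x `<=` d1)%fset -> (msupp y `<=` d2)%fset ->
  cmul x y = \sum_(a <- d1) \sum_(b <- d2) (x@_a * y@_b) *: bmul a b.
Proof.
move=> le1 le2; rewrite /cmul (big_fset_incl _ le1) /=.
  apply: eq_bigr => a _; apply: big_fset_incl => // b _ /mcoeff_outdom ->.
  by rewrite mulr0 scale0r.
move=> a _ /mcoeff_outdom xa.
by rewrite big1 // => b _; rewrite xa mul0r scale0r.
Qed.

Lemma cmulDl : left_distributive cmul +%R.
Proof.
move=> x y z; pose d := (msupp x `|` msupp y)%fset.
rewrite (@cmulEw d (msupp z) (x + y)) ?msuppD_le //.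
rewrite (@cmulEw d (msupp z) x) ?fsubsetUl //.
rewrite (@cmulEw d (msupp z) y) ?fsubsetUr //.
rewrite -big_split; apply: eq_bigr => a _.
rewrite -big_split; apply: eq_bigr => b _ /=.
by rewrite mcoeffD mulrDl scalerDl.
Qed.

Lemma cmulDr : right_distributive cmul +%R.
Proof.
move=> z x y; pose d := (msupp x `|` msupp y)%fset.
rewrite (@cmulEw (msupp z) d z (x + y)) ?msuppD_le //.
rewrite (@cmulEw (msupp z) d z x) ?fsubsetUl //.
rewrite (@cmulEw (msupp z) d z y) ?fsubsetUr //.
rewrite -big_split; apply: eq_bigr => a _.
rewrite -big_split; apply: eq_bigr => b _ /=.
by rewrite mcoeffD mulrDr scalerDl.
Qed.

Lemma cmulZl (r : k) x y : r *: cmul x y = cmul (r *: x) y.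
Proof.
rewrite (@cmulEw (msupp x) (msupp y) (r *: x)) ?msuppZ_le //.
rewrite scaler_sumr; apply: eq_bigr => a _.
rewrite scaler_sumr; apply: eq_bigr => b _.
by rewrite scalerA mcoeffZ mulrA.
Qed.

Lemma cmulZr (r : k) x y : r *: cmul x y = cmul x (r *: y).
Proof.
rewrite (@cmulEw (msupp x) (msupp y) x (r *: y)) ?msuppZ_le //.
rewrite scaler_sumr; apply: eq_bigr => a _.
rewrite scaler_sumr; apply: eq_bigr => b _.
by rewrite scalerA mcoeffZ mulrCA.
Qed.

Lemma cmul0l x : cmul 0 x = 0.
Proof. by rewrite /cmul msupp0 big_seq_fset0. Qed.

Lemma cmul0r x : cmul x 0 = 0.
Proof. by rewrite /cmul big1 // => a _; rewrite msupp0 big_seq_fset0. Qed.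

Lemma cmul_suml I (s : seq I) (F : I -> catAlg k C) y :
  cmul (\sum_(i <- s) F i) y = \sum_(i <- s) cmul (F i) y.
Proof. exact: (big_morph (cmul^~ y) (fun _ _ => cmulDl _ _ _) (cmul0l y)). Qed.

Lemma cmul_sumr I (s : seq I) (F : I -> catAlg k C) x :
  cmul x (\sum_(i <- s) F i) = \sum_(i <- s) cmul x (F i).
Proof. exact: (big_morph (cmul x) (fun _ _ => cmulDr _ _ _) (cmul0r x)). Qed.

Lemma cmul_basis a b : cmul (cbasis a) (cbasis b) = bmul a b.
Proof.
rewrite (@cmulEw [fset a]%fset [fset b]%fset) ?msuppU_le //.
by rewrite !big_seq_fset1 !mcoeffUU mulr1 scale1r.
Qed.

Lemma cbasis_ind (P : catAlg k C -> Prop) :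
  P 0 -> (forall x y, P x -> P y -> P (x + y)) ->
  (forall (r : k) x, P x -> P (r *: x)) -> (forall a, P (cbasis a)) ->
  forall x, P x.
Proof.
move=> P0 PD PZ Pb x; rewrite [x]cbasisE.
by elim/big_ind: _ => // a _; apply/PZ.
Qed.

Lemma bmulA a b c :
  cmul (cbasis a) (bmul b c) = cmul (bmul a b) (cbasis c).
Proof.
rewrite -cmulZr -cmulZl !cmul_basis /bmul.
case: (gtgt a =P gsrc b) => [ab|/eqP/negPf ab];
  case: (gtgt b =P gsrc c) => [bc|/eqP/negPf bc];
  rewrite ?scale0r ?scaler0 ?scale1r //.
- by rewrite gsrc_comp // gtgt_comp // ab bc !eqxx gcompA.
- by rewrite gtgt_comp // bc scale0r.
by rewrite gsrc_comp // ab scale0r.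
Qed.

Lemma cmulA : associative cmul.
Proof.
move=> x y z; elim/cbasis_ind: x => [|x x' hx hx'|r x hx|a].
- by rewrite !cmul0l.
- by rewrite !cmulDl hx hx'.
- by rewrite -!cmulZl hx.
elim/cbasis_ind: y => [|y y' hy hy'|r y hy|b].
- by rewrite !(cmul0l, cmul0r).
- by rewrite !(cmulDl, cmulDr) hy hy'.
- by rewrite -?cmulZl -?cmulZr hy -?cmulZl.
elim/cbasis_ind: z => [|z z' hz hz'|r z hz|c].
- by rewrite !cmul0r.
- by rewrite !cmulDr hz hz'.
- by rewrite -!cmulZr hz.
by rewrite !cmul_basis bmulA.
Qed.

Lemma cmul1l : left_id cone cmul.
Proof.
move=> x; elim/cbasis_ind: x => [|x x' hx hx'|r x hx|a].
- by rewrite cmul0r.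
- by rewrite cmulDr hx hx'.
- by rewrite -cmulZr hx.
rewrite /cone cmul_suml (bigD1_seq (gsrc a)) ?mem_index_enum ?index_enum_uniq //=.
rewrite cmul_basis /bmul gtgt_id eqxx scale1r g1comp big1 ?addr0 // => i ia.
by rewrite cmul_basis /bmul gtgt_id (negPf ia) scale0r.
Qed.

Lemma cmul1r : right_id cone cmul.
Proof.
move=> x; elim/cbasis_ind: x => [|x x' hx hx'|r x hx|a].
- by rewrite cmul0l.
- by rewrite cmulDl hx hx'.
- by rewrite -cmulZl hx.
rewrite /cone cmul_sumr (bigD1_seq (gtgt a)) ?mem_index_enum ?index_enum_uniq //=.
rewrite cmul_basis /bmul gsrc_id eqxx scale1r gcomp1 big1 ?addr0 // => i ia.
by rewrite cmul_basis /bmul gsrc_id eq_sym (negPf ia) scale0r.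
Qed.

HB.instance Definition _ := GRing.Zmodule_isPzRing.Build (catAlg k C)
  cmulA cmul1l cmul1r cmulDl cmulDr.

Lemma chomogP n x :
  reflect (forall a, glen a != n -> x@_a = 0) (x \in chomog n).
Proof.
apply: (iffP allP) => [h a na|h a ax].
  by apply: mcoeff_outdom; apply: contra na => /h.
by apply: contraTT ax => /h; rewrite -mcoeff_eq0 => ->.
Qed.

Lemma chomog_submod n : submod_closed (chomog n).
Proof.
split=> [|r x y /chomogP hx /chomogP hy]; apply/chomogP => a na.
  by rewrite mcoeff0.
by rewrite mcoeffD mcoeffZ hx // hy // mulr0 addr0.
Qed.

Lemma chomog0 n : 0 \in chomog n.
Proof. exact: (chomog_submod n).1. Qed.

Lemma chomogD n x y : x \in chomog n -> y \in chomog n -> x + y \in chomog n.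
Proof.
by move=> hx hy; rewrite -[x]scale1r; exact: (chomog_submod n).2.
Qed.

Lemma chomogZ n (r : k) x : x \in chomog n -> r *: x \in chomog n.
Proof.
move=> hx; rewrite -[_ *: _]addr0.
by apply: (chomog_submod n).2 => //; exact: chomog0.
Qed.

Lemma chomog_basis a : cbasis a \in chomog (glen a).
Proof.
apply/chomogP => b; rewrite cbasis_coef.
by case: (eqVneq a b) => [->|//]; rewrite eqxx.
Qed.

Lemma chomog1 : (1 : catAlg k C) \in chomog 0.
Proof.
rewrite -[1]/cone /cone; elim/big_ind: _ => [|x y|i _]; first exact: chomog0.
  exact: chomogD.
by rewrite -(glen_id i); exact: chomog_basis.
Qed.

Lemma chomogM m n x y :
  x \in chomog m -> y \in chomog n -> x * y \in chomog (m + n).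
Proof.
move=> /allP hx /allP hy; rewrite [x * y]/(cmul x y) /cmul big_seq.
elim/big_ind: _ => [|u v|a /hx /eqP <-]; [exact: chomog0|exact: chomogD|].
rewrite big_seq; elim/big_ind: _ => [|u v|b /hy /eqP <-].
- exact: chomog0.
- exact: chomogD.
apply: chomogZ; rewrite /bmul; case: eqP => [ab|_]; last first.
  by rewrite scale0r chomog0.
by apply: chomogZ; rewrite -glen_comp //; exact: chomog_basis.
Qed.

Lemma chomog_span x : exists n (c : nat -> catAlg k C),
  (forall i, c i \in chomog i) /\ x = \sum_(i < n) c i.
Proof.
exists (\max_(a <- msupp x) glen a).+1.
exists (fun i => \sum_(a <- msupp x | glen a == i) x@_a *: cbasis a); split.
  move=> i; elim/big_ind: _ => [|u v|a /eqP <-].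
  - exact: chomog0.
  - exact: chomogD.
  by apply: chomogZ; exact: chomog_basis.
rewrite {1}[x]cbasisE; under [RHS]eq_bigr do rewrite big_mkcond.
rewrite exchange_big /= big_seq [RHS]big_seq; apply: eq_bigr => a ax.
have lta : (glen a < (\max_(b <- msupp x) glen b).+1)%N.
  by rewrite ltnS; apply: leq_bigmax_seq.
rewrite (bigD1 (Ordinal lta)) //= eqxx big1 ?addr0 // => i ia.
by rewrite ifN //; apply: contraNneq ia => ai; apply/eqP/val_inj.
Qed.

Lemma chomog_indep n (c : nat -> catAlg k C) : (forall i, c i \in chomog i) ->
  \sum_(i < n) c i = 0 -> forall i, (i < n)%N -> c i = 0.
Proof.
move=> hc sc i lti; apply/malgP => a; rewrite mcoeff0.
have [ai|] := eqVneq (glen a) i; last by have /chomogP := hc i; apply.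
have := congr1 (mcoeff a) sc; rewrite raddf_sum mcoeff0.
rewrite (bigD1 (Ordinal lti)) //= big1 ?addr0 // => j ji.
have /chomogP := hc j; apply; apply: contraNneq ji => aj.
by apply/eqP/val_inj; rewrite /= -aj ai.
Qed.

Definition ngCatAlg : ngradedAlg k := @NGradedAlg k (catAlg k C)
  *:%R (@scalerA _ _) (@scale1r _ _) (@scalerDr _ _) (@scalerDl _ _)
  cmulZl cmulZr chomog chomog0 chomogD chomogZ chomog1 chomogM
  chomog_span chomog_indep.

Lemma cbasisM a b :
  cbasis a * cbasis b = (gtgt a == gsrc b)%:R *: cbasis (gcomp a b).
Proof. exact: cmul_basis. Qed.

End CatAlg.

Record finQuiver := FinQuiver {
  qvert : finType;
  qarr : finType;
  qsrc : qarr -> qvert;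
  qtgt : qarr -> qvert
}.

Definition kronecker_square (Q : finQuiver) : finQuiver :=
  @FinQuiver (qvert Q * qvert Q)%type (qarr Q * qarr Q)%type
    (fun pq => (qsrc pq.1, qsrc pq.2)) (fun pq => (qtgt pq.1, qtgt pq.2)).

Section Paths.
Variable Q : finQuiver.
Implicit Types (v : qvert Q) (ps qs : seq (qarr Q)).

Definition is_qpath v ps : bool :=
  if ps is p :: ps' then
    (qsrc p == v) && path (fun p1 p2 => qtgt p1 == qsrc p2) p ps'
  else true.

(* A path is stored as its source and the sequence of its arrows; the source  *)
(* is redundant if there is an arrow, and it is the trivial path at that      *)
(* vertex if there is none.                                                   *)
Record qpath := QPath {
  qpath_val : qvert Q * seq (qarr Q);
  _ : is_qpath qpath_val.1 qpath_val.2
}.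

HB.instance Definition _ := [isSub for qpath_val].
HB.instance Definition _ := [Choice of qpath by <:].

Implicit Types a b c : qpath.

Definition psrc a : qvert Q := (val a).1.
Definition parrows a : seq (qarr Q) := (val a).2.
Definition ptgt a : qvert Q := last (psrc a) (map (@qtgt Q) (parrows a)).
Definition plen a : nat := size (parrows a).
Definition ptriv v : qpath := @QPath (v, [::]) isT.

(* concatenation; the value [a] is used if [ptgt a != psrc b] makes the       *)
(* sequence of arrows ill-formed                                              *)
Definition pcat a b : qpath := insubd a (psrc a, parrows a ++ parrows b).

Lemma is_qpath_cons v p ps :
  is_qpath v (p :: ps) = (qsrc p == v) && is_qpath (qtgt p) ps.
Proof. by case: ps => //= p' ps; rewrite (eq_sym (qtgt p)). Qed.

Lemma is_qpath_cat v ps qs : is_qpath v (ps ++ qs) =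
  is_qpath v ps && is_qpath (last v (map (@qtgt Q) ps)) qs.
Proof.
elim: ps v => // p ps IHps v.
by rewrite cat_cons !is_qpath_cons IHps andbA.
Qed.

Lemma qpath_eq a b : psrc a = psrc b -> parrows a = parrows b -> a = b.
Proof.
case: a b => [[v ps] pa] [[w qs] pb]; rewrite /psrc /parrows /= => vw pq.
by apply: val_inj; rewrite /= vw pq.
Qed.

Lemma pcat_val a b : ptgt a = psrc b ->
  val (pcat a b) = (psrc a, parrows a ++ parrows b).
Proof.
move=> ab; rewrite /pcat insubdK //= unfold_in /= is_qpath_cat -/(ptgt a) ab.
by rewrite (valP a) (valP b).
Qed.

Lemma psrc_cat a b : ptgt a = psrc b -> psrc (pcat a b) = psrc a.
Proof. by move=> ab; rewrite {1}/psrc pcat_val. Qed.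

Lemma parrows_cat a b :
  ptgt a = psrc b -> parrows (pcat a b) = parrows a ++ parrows b.
Proof. by move=> ab; rewrite {1}/parrows pcat_val. Qed.

Lemma ptgt_cat a b : ptgt a = psrc b -> ptgt (pcat a b) = ptgt b.
Proof.
move=> ab; rewrite {1}/ptgt psrc_cat // parrows_cat // map_cat last_cat.
by rewrite -/(ptgt a) ab.
Qed.

Lemma plen_cat a b : ptgt a = psrc b -> plen (pcat a b) = (plen a + plen b)%N.
Proof. by move=> ab; rewrite /plen parrows_cat // size_cat. Qed.

Lemma pcatA a b c : ptgt a = psrc b -> ptgt b = psrc c ->
  pcat a (pcat b c) = pcat (pcat a b) c.
Proof.
move=> ab bc; have a_bc : ptgt a = psrc (pcat b c) by rewrite psrc_cat.
have ab_c : ptgt (pcat a b) = psrc c by rewrite ptgt_cat.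
by apply: qpath_eq; rewrite ?psrc_cat ?parrows_cat // catA.
Qed.

Lemma pcat1 a : pcat a (ptriv (ptgt a)) = a.
Proof. by apply: qpath_eq; rewrite ?psrc_cat ?parrows_cat // cats0. Qed.

Lemma p1cat a : pcat (ptriv (psrc a)) a = a.
Proof. by apply: qpath_eq; rewrite ?psrc_cat ?parrows_cat. Qed.

Definition pathCat : gradedCat := @GradedCat (qvert Q) qpath
  psrc ptgt ptriv pcat plen
  (fun=> erefl) (fun=> erefl) psrc_cat ptgt_cat pcatA pcat1 p1cat
  (fun=> erefl) plen_cat.

End Paths.

Section FacePairs.
Variable Q : finQuiver.

(* The indices (a, b) of the basis elements x_{a,b} of the face algebra.      *)
Record fpair := FPair {
  fpair_val : qpath Q * qpath Q;
  _ : plen fpair_val.1 == plen fpair_val.2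
}.

HB.instance Definition _ := [isSub for fpair_val].
HB.instance Definition _ := [Choice of fpair by <:].

Implicit Types u v w : fpair.

Definition fsrc u : qvert Q * qvert Q := (psrc (val u).1, psrc (val u).2).
Definition ftgt u : qvert Q * qvert Q := (ptgt (val u).1, ptgt (val u).2).
Definition ftriv (ij : qvert Q * qvert Q) : fpair :=
  @FPair (ptriv ij.1, ptriv ij.2) (eqxx 0%N).
Definition fcat u v : fpair :=
  insubd u (pcat (val u).1 (val v).1, pcat (val u).2 (val v).2).
Definition flen u : nat := plen (val u).1.

Lemma fsrc_triv ij : fsrc (ftriv ij) = ij.
Proof. by case: ij. Qed.

Lemma ftgt_triv ij : ftgt (ftriv ij) = ij.
Proof. by case: ij. Qed.

Lemma fcomposable u v : ftgt u = fsrc v ->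
  ptgt (val u).1 = psrc (val v).1 /\ ptgt (val u).2 = psrc (val v).2.
Proof. by case. Qed.

Lemma fcat_val u v : ftgt u = fsrc v ->
  val (fcat u v) = (pcat (val u).1 (val v).1, pcat (val u).2 (val v).2).
Proof.
move=> /fcomposable[uv1 uv2]; rewrite /fcat insubdK // unfold_in /=.
by rewrite !plen_cat // (eqP (valP u)) (eqP (valP v)).
Qed.

Lemma fsrc_cat u v : ftgt u = fsrc v -> fsrc (fcat u v) = fsrc u.
Proof.
by move=> uv; have [uv1 uv2] := fcomposable uv;
  rewrite {1}/fsrc fcat_val //= !psrc_cat.
Qed.

Lemma ftgt_cat u v : ftgt u = fsrc v -> ftgt (fcat u v) = ftgt v.
Proof.
by move=> uv; have [uv1 uv2] := fcomposable uv;
  rewrite {1}/ftgt fcat_val //= !ptgt_cat.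
Qed.

Lemma flen_cat u v : ftgt u = fsrc v -> flen (fcat u v) = (flen u + flen v)%N.
Proof.
by move=> uv; have [uv1 uv2] := fcomposable uv;
  rewrite {1}/flen fcat_val //= plen_cat.
Qed.

Lemma fcatA u v w : ftgt u = fsrc v -> ftgt v = fsrc w ->
  fcat u (fcat v w) = fcat (fcat u v) w.
Proof.
move=> uv vw; have [uv1 uv2] := fcomposable uv; have [vw1 vw2] := fcomposable vw.
by apply: val_inj; rewrite !fcat_val ?fsrc_cat ?ftgt_cat //= !pcatA.
Qed.

Lemma fcat1 u : fcat u (ftriv (ftgt u)) = u.
Proof. by apply: val_inj; rewrite fcat_val //= !pcat1; case: (val u). Qed.

Lemma f1cat u : fcat (ftriv (fsrc u)) u = u.
Proof. by apply: val_inj; rewrite fcat_val //= !p1cat; case: (val u). Qed.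

Definition faceCat : gradedCat := @GradedCat (qvert Q * qvert Q)%type fpair
  fsrc ftgt ftriv fcat flen
  fsrc_triv ftgt_triv fsrc_cat ftgt_cat fcatA fcat1 f1cat
  (fun=> erefl) flen_cat.

End FacePairs.

Definition path_algebra (k : fieldType) (Q : finQuiver) : ngradedAlg k :=
  ngCatAlg k (pathCat Q).

Definition face_algebra (k : fieldType) (Q : finQuiver) : ngradedAlg k :=
  ngCatAlg k (faceCat Q).

(* x_{a,b} x_{c,d} = delta_{t(a),s(c)} delta_{t(b),s(d)} x_{ac,bd} *)
Lemma face_basisM (k : fieldType) (Q : finQuiver) (u v : fpair Q) :
  let x w : face_algebra k Q := cbasis k (w : gmor (faceCat Q)) in
  let: (a, b) := val u in let: (c, d) := val v in
  x u * x v =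
  ascale ((ptgt a == psrc c)%:R * (ptgt b == psrc d)%:R) (x (fcat u v)).
Proof.
case: u v => [[a b] ab] [[c d] cd] /=.
rewrite -natrM mulnb; exact: (cbasisM k).
Qed.

(* Main.v *)
Require Import Defs.
From mathcomp Require Import all_boot all_order all_algebra.
From HB Require Import structures.
From mathcomp Require Import finmap.
From mathcomp.multinomials Require Import monalg.

(** Both algebras are algebras of graded categories on the same set of
    objects, the pairs of vertices of [Q]: the product of two basis elements is
    their composite or zero.  It is therefore enough to identify the two
    categories, and no computation with linear combinations is specific to
    quivers.

    The linear extension of a bijection of morphisms just relabels
    coefficients ([cpush_coef]), so linearity, bijectivity and preservation of
    the grading are read off coefficient by coefficient; multiplicativity is
    checked on basis elements, where it is functoriality ([cpushM]).  This is
    [iso_catAlg].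

    The identification of the categories is zipping: two paths of the same
    length in [Q], read in parallel, are the same thing as one path in the
    Kronecker square, because its arrows are the pairs of arrows and its source
    and target maps are componentwise ([is_qpath_kronecker]).  The equal length
    of the two paths in the index of a basis element of the face algebra is
    exactly what makes zipping injective and compatible with concatenation. *)

Set Implicit Arguments.
Unset Strict Implicit.
Unset Printing Implicit Defensive.

Import GRing.Theory.

Local Open Scope ring_scope.

Section LinearExtension.

Variables (k : fieldType) (C D : gradedCat).
Variables (F : gob C -> gob D) (G : gmor C -> gmor D).
Implicit Types (x y : catAlg k C) (a b : gmor C).

Definition cpush x : catAlg k D := \sum_(a <- msupp x) x@_a *: cbasis k (G a).

Variables (F' : gob D -> gob C) (G' : gmor D -> gmor C).
Hypotheses (FK : cancel F F') (F'K : cancel F' F).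
Hypotheses (GK : cancel G G') (G'K : cancel G' G).
Hypothesis G_src : forall a, gsrc (G a) = F (gsrc a).
Hypothesis G_tgt : forall a, gtgt (G a) = F (gtgt a).
Hypothesis G_id : forall i, G (gid i) = gid (F i).
Hypothesis G_comp :
  forall a b, gtgt a = gsrc b -> G (gcomp a b) = gcomp (G a) (G b).
Hypothesis G_len : forall a, glen (G a) = glen a.

(** Since [G] is a bijection, at most one term of [cpush x] meets [d].  Linearity
    becomes immediate in this form, where the support of [x], which is not
    additive in [x], no longer occurs. *)
Lemma cpush_coef x d : (cpush x)@_d = x@_(G' d).
Proof.
rewrite /cpush raddf_sum /= [in RHS](cbasisE x) [RHS]raddf_sum /=.
apply: eq_bigr => a _; rewrite !mcoeffZ !cbasis_coef.
by rewrite -(can_eq GK) G'K.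
Qed.

Lemma cpushD x y : cpush (x + y) = cpush x + cpush y.
Proof. by apply/malgP => d; rewrite mcoeffD !cpush_coef mcoeffD. Qed.

Lemma cpushZ c x : cpush (c *: x) = c *: cpush x.
Proof. by apply/malgP => d; rewrite mcoeffZ !cpush_coef mcoeffZ. Qed.

Lemma cpush0 : cpush 0 = 0.
Proof. by apply/malgP => d; rewrite cpush_coef !mcoeff0. Qed.

Lemma cpush_basis a : cpush (cbasis k a) = cbasis k (G a).
Proof.
by apply/malgP => d; rewrite cpush_coef !cbasis_coef -(can_eq GK) G'K.
Qed.

Lemma cpush1 : cpush 1 = 1.
Proof.
rewrite -[1 in LHS]/(cone k C) -[1 in RHS]/(cone k D) /cone.
rewrite (big_morph cpush cpushD cpush0) [RHS](reindex F) /=; last first.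
  by apply: onW_bij; exists F'.
by apply: eq_bigr => i _; rewrite cpush_basis G_id.
Qed.

(** Injectivity on objects matters here: [G a] and [G b] must not become
    composable when [a] and [b] are not. *)
Lemma cpushM x y : cpush (x * y) = cpush x * cpush y.
Proof.
elim/cbasis_ind: x => [|x x' hx hx'|c x hx|a].
- by rewrite mul0r cpush0 mul0r.
- by rewrite mulrDl !cpushD mulrDl hx hx'.
- rewrite cpushZ -[_ * y]/(cmul _ _) -[RHS]/(cmul _ _) -!cmulZl cpushZ.
  by congr (_ *: _).
elim/cbasis_ind: y => [|y y' hy hy'|c y hy|b].
- by rewrite mulr0 cpush0 mulr0.
- by rewrite mulrDr !cpushD mulrDr hy hy'.
- rewrite cpushZ -[_ * (c *: y)]/(cmul _ _) -[RHS]/(cmul _ _) -!cmulZr cpushZ.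
  by congr (_ *: _).
rewrite !cpush_basis !cbasisM cpushZ cpush_basis G_tgt G_src (can_eq FK).
by case: eqP => [ab|_]; [rewrite G_comp|rewrite !scale0r].
Qed.

Lemma cpush_bij : bijective cpush.
Proof.
exists (fun z => \sum_(d <- msupp z) z@_d *: cbasis k (G' d)) => z.
  apply/malgP => a; rewrite -[in RHS](GK a) -cpush_coef.
  rewrite [in RHS](cbasisE (cpush z)) !raddf_sum /=; apply: eq_bigr => d _.
  by rewrite !mcoeffZ !cbasis_coef -(can_eq G'K) GK.
apply/malgP => d; rewrite cpush_coef [in RHS](cbasisE z) !raddf_sum /=.
by apply: eq_bigr => e _; rewrite !mcoeffZ !cbasis_coef (can_eq G'K).
Qed.

Lemma cpush_homog n x : (cpush x \in chomog n) = (x \in chomog n).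
Proof.
apply/chomogP/chomogP => hx a an.
  by rewrite -(GK a) -cpush_coef hx // G_len.
by rewrite cpush_coef hx // -G_len G'K.
Qed.

(** An isomorphism of graded categories induces one of their algebras. *)
Lemma iso_catAlg : graded_alg_iso (ngCatAlg k C) (ngCatAlg k D).
Proof.
pose cpush_additive := GRing.isSemiAdditive.Build _ _ cpush (conj cpush0 cpushD).
pose cpush_multiplicative :=
  GRing.isMonoidMorphism.Build _ _ cpush (conj cpush1 cpushM).
pose f : {rmorphism ngCatAlg k C -> ngCatAlg k D} :=
  HB.pack cpush cpush_additive cpush_multiplicative.
exists f; split; [exact: cpush_bij|exact: cpushZ|exact: cpush_homog].
Qed.

End LinearExtension.

Section Zip.

Variable Q : finQuiver.
Local Notation Q2 := (kronecker_square Q).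
Implicit Types (u v : fpair Q) (a b : qpath Q2).

(** The source and target maps of the Kronecker square are componentwise, so the
    condition that consecutive arrows match splits into one condition on each
    component. *)
Lemma is_qpath_kronecker (ij : qvert Q2) (ps : seq (qarr Q2)) :
  is_qpath ij ps = is_qpath ij.1 (unzip1 ps) && is_qpath ij.2 (unzip2 ps).
Proof.
elim: ps ij => // p ps IHps [i j].
rewrite -[unzip1 _]/(p.1 :: unzip1 ps) -[unzip2 _]/(p.2 :: unzip2 ps).
by rewrite !is_qpath_cons IHps /= xpair_eqE andbACA.
Qed.

Lemma size_parrows u : size (parrows (val u).1) = size (parrows (val u).2).
Proof. exact: eqP (valP u). Qed.

Lemma zip_is_qpath u :
  is_qpath (Q := Q2) (fsrc u) (zip (parrows (val u).1) (parrows (val u).2)).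
Proof.
rewrite is_qpath_kronecker unzip1_zip ?unzip2_zip ?size_parrows //=.
by rewrite (valP (val u).1) (valP (val u).2).
Qed.

Definition fzip u : qpath Q2 :=
  @QPath Q2 (fsrc u, zip (parrows (val u).1) (parrows (val u).2))
    (zip_is_qpath u).

Lemma unzip1_is_qpath a : is_qpath (psrc a).1 (unzip1 (parrows a)).
Proof. by have := valP a; rewrite is_qpath_kronecker => /andP[]. Qed.

Lemma unzip2_is_qpath a : is_qpath (psrc a).2 (unzip2 (parrows a)).
Proof. by have := valP a; rewrite is_qpath_kronecker => /andP[]. Qed.

Lemma unzip_plen a :
  plen (@QPath Q (_, _) (unzip1_is_qpath a)) ==
  plen (@QPath Q (_, _) (unzip2_is_qpath a)).
Proof. by rewrite /plen /parrows /= !size_map. Qed.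

Definition funzip a : fpair Q := @FPair Q (_, _) (unzip_plen a).

Lemma fzipK : cancel fzip funzip.
Proof.
move=> u; apply: val_inj; rewrite /= [RHS]surjective_pairing.
by congr (_, _); apply: qpath_eq;
  rewrite //= /parrows /= ?unzip1_zip ?unzip2_zip ?size_parrows.
Qed.

Lemma funzipK : cancel funzip fzip.
Proof.
move=> a; apply: qpath_eq; first by rewrite [RHS]surjective_pairing.
exact: zip_unzip.
Qed.

Lemma ptgt_fzip u : ptgt (fzip u) = ftgt u.
Proof.
rewrite /ftgt {1}/ptgt -[psrc _]/(fsrc u) /fsrc -[parrows _]/(zip _ _) /ptgt.
move: (psrc _) (psrc _) (parrows _) (parrows _) (size_parrows u) => i j ps qs.
by elim: ps qs i j => [|p ps IHps] [|q qs] //= i j [] /IHps->.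
Qed.

Lemma fzip_triv ij : fzip (ftriv ij) = ptriv (Q := Q2) ij.
Proof. by apply: qpath_eq => //; case: ij. Qed.

(** Zipping commutes with concatenation only because the two first factors have
    the same length: otherwise arrows of different factors would be paired. *)
Lemma fzip_cat u v : ftgt u = fsrc v -> fzip (fcat u v) = pcat (fzip u) (fzip v).
Proof.
move=> uv; have [uv1 uv2] := fcomposable uv.
have zuv : ptgt (fzip u) = psrc (fzip v) by rewrite ptgt_fzip.
apply: qpath_eq; first by rewrite psrc_cat // -[LHS]/(fsrc _) fsrc_cat.
rewrite parrows_cat // /parrows /= fcat_val // -!/(parrows _) !parrows_cat //.
by rewrite zip_cat // size_parrows.
Qed.

Lemma plen_fzip u : plen (fzip u) = flen u.
Proof. by rewrite /plen size1_zip // size_parrows. Qed.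

End Zip.

Theorem proposition3p4 (k : fieldType) (Q : finQuiver) :
  graded_alg_iso (face_algebra k Q) (path_algebra k (kronecker_square Q)).
Proof.
exact: (@iso_catAlg k (faceCat Q) (pathCat (kronecker_square Q)) id
  (@fzip Q) id (@funzip Q) (fun=> erefl) (fun=> erefl) (@fzipK Q) (@funzipK Q)
  (fun=> erefl) (@ptgt_fzip Q) (@fzip_triv Q) (@fzip_cat Q) (@plen_fzip Q)).
Qed.
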